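(* Let $\varepsilon$ be an equation that propagates in a class $\mathcal X$ of algebras (all of the same signature, with $\varepsilon$ an equation in that signature). Then $\varepsilon$ propagates in $\mathbf S(\mathcal X)$ and in $\mathbf P(\mathcal X)$.
   Context: An equation $\varepsilon=\varepsilon(x_1,\dots,x_n)$ with $n$ variables in the signature of an algebra $X$ propagates in $X$ if for all $x_1,\dots,x_n\in X$: if $\varepsilon(x_1,\dots,x_n)$ holds, then $\varepsilon(y_1,\dots,y_n)$ holds for all $y_1,\dots,y_n$ in the subalgebra $\langle x_1,\dots,x_n\rangle$ of $X$ generated by $x_1,\dots,x_n$. An equation propagates in a class of algebras if it propagates in every member of the class. $\mathbf S(\mathcal X)$ is the class of all subalgebras of algebras from $\mathcal X$, and $\mathbf P(\mathcal X)$ is the class of all (arbitrary) direct products of algebras from $\mathcal X$. *)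

(* Defs.v *)
From mathcomp Require Import all_boot.
From mathcomp Require Import boolp classical_sets.

Set Implicit Arguments.
Unset Strict Implicit.
Unset Printing Implicit Defensive.

Local Open Scope classical_set_scope.

(* Operations are finitary; nullary symbols are the constants. *)
Record signature : Type := Signature {
  symbol :> Type;
  arity : symbol -> nat
}.

(* Carriers may be empty. *)
Record algebra (sg : signature) : Type := Algebra {
  carrier :> Type;
  op : forall f : sg, ('I_(arity f) -> carrier) -> carrier
}.

Inductive term (sg : signature) (n : nat) : Type :=
| Var of 'I_n
| App (f : sg) of ('I_(arity f) -> term sg n).

Fixpoint eval (sg : signature) (n : nat) (A : algebra sg) (x : 'I_n -> A)
    (t : term sg n) : A :=
  match t with
  | Var i => x i
  | App f args => op (fun j => eval x (args j))
  end.

Record equation (sg : signature) (n : nat) : Type := Equation {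
  lhs : term sg n;
  rhs : term sg n
}.

Definition holds (sg : signature) (n : nat) (A : algebra sg)
    (e : equation sg n) (x : 'I_n -> A) : Prop :=
  eval x (lhs e) = eval x (rhs e).

Definition subuniverse (sg : signature) (A : algebra sg) (U : set A) : Prop :=
  forall (f : sg) (args : 'I_(arity f) -> A),
    (forall j, U (args j)) -> U (op args).

Definition generated (sg : signature) (A : algebra sg) (G : set A) : set A :=
  smallest (@subuniverse sg A) G.

Definition subalgebra (sg : signature) (A : algebra sg) (U : set A)
    (hU : subuniverse U) : algebra sg :=
  @Algebra sg (set_type U) (fun f args =>
    SigSub (mem_set (hU f (fun j => val (args j))
                          (fun j => set_mem (valP (args j)))))).

Definition product (sg : signature) (I : Type) (A : I -> algebra sg) :
    algebra sg :=
  @Algebra sg (forall i, A i) (fun f args i => op (fun j => args j i)).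

Definition propagates_in (sg : signature) (n : nat) (e : equation sg n)
    (A : algebra sg) : Prop :=
  forall x : 'I_n -> A, holds e x ->
  forall y : 'I_n -> A, (forall i, generated (range x) (y i)) -> holds e y.

(* Classes are Prop-valued predicates rather than classical sets: MathComp's
   set is universe-monomorphic, and set_type puts the carriers of algebras in
   the very universe that bounds the argument of set. *)
Definition algebra_class (sg : signature) : Type := algebra sg -> Prop.

Definition propagates (sg : signature) (n : nat) (e : equation sg n)
    (X : algebra_class sg) : Prop :=
  forall A, X A -> propagates_in e A.

Definition S_class (sg : signature) (X : algebra_class sg) :
    algebra_class sg :=
  fun B => exists (A : algebra sg) (U : set A) (hU : subuniverse U),
    X A /\ B = subalgebra hU.

(* The index type I may be empty: the trivial algebra is in P_class X. *)
Definition P_class (sg : signature) (X : algebra_class sg) :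
    algebra_class sg :=
  fun B => exists (I : Type) (A : I -> algebra sg),
    (forall i, X (A i)) /\ B = product A.

(* Main.v *)
Require Import Defs.
From mathcomp Require Import all_boot.
From mathcomp Require Import boolp classical_sets.

(** Propagation passes to any algebra [B] with a point-separating family of
    homomorphisms into algebras where the equation propagates: a homomorphism
    preserves solutions and maps the subalgebra generated by [x] into the one
    generated by the image of [x], so the equation holds at [y] after every
    homomorphism of the family, hence in [B]. Subalgebras are separated by their
    inclusion, products by their projections. *)

Set Implicit Arguments.
Unset Strict Implicit.
Unset Printing Implicit Defensive.

Local Open Scope classical_set_scope.

Definition homomorphism (sg : signature) (B A : algebra sg) (h : B -> A) : Prop :=
  forall (f : sg) (args : 'I_(arity f) -> B),
    h (op args) = op (fun j => h (args j)).

Lemma eval_hom (sg : signature) (n : nat) (B A : algebra sg) (h : B -> A)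
    (x : 'I_n -> B) (t : term sg n) :
  homomorphism h -> h (eval x t) = eval (fun i => h (x i)) t.
Proof.
move=> hom; elim: t => [//|f args IH] /=.
by rewrite hom; congr op; apply: funext.
Qed.

Lemma holds_hom (sg : signature) (n : nat) (e : equation sg n)
    (B A : algebra sg) (h : B -> A) (x : 'I_n -> B) :
  homomorphism h -> holds e x -> holds e (fun i => h (x i)).
Proof. by move=> hom ex; rewrite /holds -!eval_hom // ex. Qed.

(** Preimages of subuniverses under [h] are subuniverses, so a [U] containing the image tuple pulls
    back to one containing [x], hence [y]. *)
Lemma generated_hom (sg : signature) (n : nat) (B A : algebra sg) (h : B -> A)
    (x : 'I_n -> B) (y : B) :
  homomorphism h -> generated (range x) y ->
  generated (range (fun i => h (x i))) (h y).
Proof.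
move=> hom gy U [subU xU]; apply: (gy (h @^-1` U)); split.
- by move=> f args Uargs; rewrite /preimage /= hom; apply: subU.
- by move=> _ [i _ <-]; apply: xU; exists i.
Qed.

Lemma propagates_in_separated (sg : signature) (n : nat) (e : equation sg n)
    (B : algebra sg) (I : Type) (A : I -> algebra sg)
    (h : forall i, B -> A i) :
  (forall i, homomorphism (h i)) ->
  (forall u v, (forall i, h i u = h i v) -> u = v) ->
  (forall i, propagates_in e (A i)) ->
  propagates_in e B.
Proof.
move=> hom sep eA x ex y gy; apply: sep => i; rewrite !eval_hom //.
apply: (eA i _ (holds_hom (hom i) ex)) => k.
exact: generated_hom.
Qed.

Theorem corollary1p3 (sg : signature) (n : nat) (e : equation sg n)
    (X : algebra_class sg) (he : propagates e X) :
  propagates e (S_class X) /\ propagates e (P_class X).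
Proof.
split.
- move=> _ [A [U [hU [XA ->]]]].
  (* The inclusion alone separates points, so [unit] indexes the family; it is a homomorphism by
     conversion. *)
  apply: (@propagates_in_separated _ _ _ (subalgebra hU) unit (fun=> A)
            (fun=> val)) => //.
  + by move=> u v /(_ tt); apply: val_inj.
  + by move=> _; apply: he.
- move=> _ [I [A [XA ->]]].
  (* Operations act coordinatewise, so projections are homomorphisms by conversion. *)
  apply: (@propagates_in_separated _ _ _ (product A) I A (fun i u => u i)) => //.
  + by move=> u v uv; apply: functional_extensionality_dep.
  + by move=> i; apply: he.
Qed.
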